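(* Let $r\ge 1$, let $\Gamma=\mathbb{Z}_2^r$ (the direct sum of $r$ copies of $\mathbb{Z}_2$), let $S\subseteq\Gamma$ with $0\notin S$, let $n=(2,2,\ldots,2)$, let $v\in\Gamma$, let $a\in\Gamma$ be of order $2$, and let $t\in\mathbb{R}$. Put $$N=\left\{(x,y)\ \middle|\ x,y\in\Gamma,\ x\mathrel{\dot>}y,\ \mathrm{wt}\left(\frac{2a(x-y)}{n}\right)\text{ is even}\right\}.$$ The cubelike graph $G=\mathrm{Cay}(\Gamma,S)$ has fractional revival at time $t$ between $v$ and $v+a$ if and only if $$\frac{t}{2\pi}\sum_{s\in S}\left((-1)^{s\cdot x}-(-1)^{s\cdot y}\right)\in\mathbb{Z}\quad\text{for all }(x,y)\in N.$$ Moreover, if these conditions hold, then there is a minimum positive time $t=\frac{2\pi}{M}$ at which fractional revival occurs between $v$ and $v+a$, where $M=\gcd\left\{\sum_{s\in S}((-1)^{s\cdot x}-(-1)^{s\cdot y})\ \middle|\ (x,y)\in N\right\}$.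
   Context: $\mathbb{Z}_2=\{0,1\}$ is the additive group of integers modulo $2$. The Cayley graph $\mathrm{Cay}(\Gamma,S)$ has vertex set $\Gamma$, with $u,v$ adjacent if and only if $u-v\in S$; for $\Gamma=\mathbb{Z}_2^r$ it is called a cubelike graph. For $s,x\in\Gamma$, $s\cdot x=\sum_{i=1}^r s_ix_i$. For $x,y\in\Gamma$, with coordinates regarded as integers in $\{0,1\}$, $x\mathrel{\dot>}y$ means that there is $i\in\{1,\ldots,r\}$ with $x_1=y_1,\ldots,x_{i-1}=y_{i-1}$ and $x_i>y_i$. The notation $\mathrm{wt}$ denotes the sum of all coordinates of a tuple, with products and quotients taken coordinatewise; here $\mathrm{wt}\left(\frac{2a(x-y)}{n}\right)=\sum_{s=1}^r a_s(x_s-y_s)$, computed with integer representatives. For a graph $G$ with adjacency matrix $A_G$, the transition matrix is $H_{A_G}(t)=\exp(\mathrm{i}tA_G)$, $t\in\mathbb{R}$, and $\mathbf{e}_u$ is the standard basis vector indexed by the vertex $u$. For distinct vertices $u,v$, $G$ has fractional revival at time $t$ from $u$ to $v$ if $H_{A_G}(t)\mathbf{e}_u=\alpha\mathbf{e}_u+\beta\mathbf{e}_v$ for some complex numbers $\alpha,\beta$ with $|\alpha|^2+|\beta|^2=1$ (equivalently $|H_{A_G}(t)_{u,u}|^2+|H_{A_G}(t)_{u,v}|^2=1$); the cases $\alpha=0$ (perfect state transfer) and $\beta=0$ (periodicity at $u$) are included. Fractional revival from $u$ to $v$ at time $t$ implies fractional revival from $v$ to $u$ at time $t$, so one speaks of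 fractional revival between $u$ and $v$.
   Formalization: The ''moreover'' part assumes M ≠ 0: if M = 0 (e.g. r = 1, S = {1}, a = 1, where N is empty), fractional revival occurs at every time, so no minimum positive time exists and 2π/M is undefined. *)

(* Defs.v *)
From HB Require Import structures.
From mathcomp Require Import all_boot all_order all_fingroup all_algebra.
From mathcomp Require Import complex.
From mathcomp Require Import all_classical all_reals all_analysis.

Set Implicit Arguments.
Unset Strict Implicit.
Unset Printing Implicit Defensive.

Import Order.TTheory GRing.Theory Num.Theory.
Import numFieldNormedType.Exports.

Local Open Scope complex_scope.
Local Open Scope ring_scope.

(* The limit is taken in the normed space 'M[C]_n. *)
Definition mx_exp (C : numClosedFieldType) (n : nat) (A : 'M[C]_n) : 'M[C]_n :=
  limn (series (fun k : nat => (k`!%:R)^-1 *: A ^+ k)).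

(* A graph on a finite type V is given by its adjacency relation. Matrices and
   vectors "indexed by V" are indexed by 'I_#|V| along enum_val/enum_rank. *)
Definition adjacency_mx (C : nzRingType) (V : finType) (e : rel V) :
    'M[C]_#|V| :=
  \matrix_(i, j) (e (enum_val i) (enum_val j))%:R.

Definition vertex_vec (C : nzRingType) (V : finType) (u : V) : 'cV[C]_#|V| :=
  delta_mx (enum_rank u) 0.

Definition transition_mx (R : realType) (V : finType) (e : rel V) (t : R) :
    'M[R[i]]_#|V| :=
  mx_exp (('i * t%:C) *: adjacency_mx R[i] e).

Definition frac_revival_from (R : realType) (V : finType) (e : rel V) (t : R)
    (u v : V) : Prop :=
  u <> v /\
  exists alpha beta : R[i],
    `|alpha| ^+ 2 + `|beta| ^+ 2 = 1 /\
    transition_mx e t *m vertex_vec R[i] u =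
      alpha *: vertex_vec R[i] u + beta *: vertex_vec R[i] v.

Definition frac_revival_between (R : realType) (V : finType) (e : rel V)
    (t : R) (u v : V) : Prop :=
  frac_revival_from e t u v /\ frac_revival_from e t v u.

Definition cayley (Gamma : finZmodType) (S : {set Gamma}) : rel Gamma :=
  [rel u v | u - v \in S].

(* In the definitions below the coordinates of elements of Z_2^r are replaced by
   their representatives 0, 1 in nat, through the coercion 'Z_2 >-> nat. *)

Definition lex_gt (r : nat) (x y : 'rV['Z_2]_r) : bool :=
  [exists i : 'I_r,
    [forall j : 'I_r, (j < i)%N ==> (x ord0 j == y ord0 j)] && (y ord0 i < x ord0 i)%N].

(* wt (2 a (x - y) / n) for n = (2, ..., 2). *)
Definition wt_diff (r : nat) (a x y : 'rV['Z_2]_r) : int :=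
  \sum_(i < r) (a ord0 i : nat)%:Z * ((x ord0 i : nat)%:Z - (y ord0 i : nat)%:Z).

Definition Npairs (r : nat) (a : 'rV['Z_2]_r) :
    {set 'rV['Z_2]_r * 'rV['Z_2]_r} :=
  [set p | lex_gt p.1 p.2 && (2 %| wt_diff a p.1 p.2)%Z].

(* Used only as an exponent of -1, so that its value modulo 2 alone matters. *)
Definition dot (r : nat) (s x : 'rV['Z_2]_r) : nat :=
  (\sum_(i < r) s ord0 i * x ord0 i)%N.

Definition char_sum_diff (r : nat) (S : {set 'rV['Z_2]_r})
    (x y : 'rV['Z_2]_r) : int :=
  \sum_(s in S) ((-1) ^+ dot s x - (-1) ^+ dot s y).

(* The gcd of a family of integers is the (nonnegative) gcd of the absolute
   values; it is 0 if the family is empty or all its members vanish. *)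
Definition Mgcd (r : nat) (S : {set 'rV['Z_2]_r}) (a : 'rV['Z_2]_r) : nat :=
  \big[gcdn/0%N]_(p in Npairs a) `|char_sum_diff S p.1 p.2|%N.

(* Main.v *)
Require Import Defs.
From HB Require Import structures.
From mathcomp Require Import all_boot all_order all_fingroup all_algebra.
From mathcomp Require Import complex.
From mathcomp Require Import all_classical all_reals all_analysis.
From mathcomp Require Import ring lra zify.

(* The characters chi_x of Z_2^r form a common eigenbasis of all cubelike graphs,
   with eigenvalues lambda_x = sum_(s in S) (-1)^(s.x), so the transition matrix
   acts on chi_x by exp(i t lambda_x). Expanding e_v in this basis, revival
   H(t) e_v = alpha e_v + beta e_(v+a) says exp(i t lambda_x) = alpha + beta (-1)^(a.x)
   for all x, i.e. exp(i t lambda_x) depends only on the parity of a.x. Hence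
   revival holds iff t (lambda_x - lambda_y) is in 2 pi Z whenever a.x and a.y have
   the same parity; by Bezout these differences may be replaced by their gcd. *)

Set Implicit Arguments.
Unset Strict Implicit.
Unset Printing Implicit Defensive.

Import Order.TTheory GRing.Theory Num.Theory.
Import numFieldNormedType.Exports.

Local Open Scope complex_scope.
Local Open Scope ring_scope.

(** * Exponentials of diagonalizable matrices *)

(** Every power of [Q *m diag_mx d *m Q'] is a combination of the fixed matrices [P j] with
    coefficients [d 0 j ^+ k], so the matrix series reduces to one scalar series per eigenvalue. *)
Lemma mx_exp_diag (C : numClosedFieldType) (n : nat) (Q Q' : 'M[C]_n)
    (d e : 'rV[C]_n) :
  Q' *m Q = 1%:M ->
  (forall j, series (fun k => (k`!%:R)^-1 * d 0 j ^+ k) @ \oo --> e 0 j)%classic ->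
  mx_exp (Q *m diag_mx d *m Q') = Q *m diag_mx e *m Q'.
Proof.
move=> Q'Q d_e.
pose P j := Q *m delta_mx j j *m Q'.
have sumP (f : 'rV[C]_n) : Q *m diag_mx f *m Q' = \sum_j f 0 j *: P j.
  rewrite diag_mx_sum_delta mulmx_sumr mulmx_suml; apply: eq_bigr => j _.
  by rewrite -scalemxAr -scalemxAl.
have powE k : (Q *m diag_mx d *m Q') ^+ k = \sum_j d 0 j ^+ k *: P j.
  have -> : \sum_j d 0 j ^+ k *: P j = Q *m diag_mx (\row_j d 0 j ^+ k) *m Q'.
    by rewrite sumP; apply: eq_bigr => j _; rewrite mxE.
  elim: k => [|k IHk].
    rewrite (_ : diag_mx _ = 1%:M) ?mulmx1 ?(mulmx1C Q'Q) //.
    by apply/matrixP => i j; rewrite !mxE expr0.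
  rewrite exprS IHk -mulmxE !mulmxA -(mulmxA _ Q' Q) Q'Q mulmx1 -(mulmxA Q).
  congr (_ *m _ *m _); apply/matrixP => i j; rewrite mul_diag_mx !mxE.
  by case: eqP => [->|_]; rewrite ?mulr1n ?exprS // mulr0n mulr0.
rewrite /mx_exp; apply: cvg_lim; first exact: norm_hausdorff.
rewrite (sumP e).
have -> : series (fun k => (k`!%:R)^-1 *: (Q *m diag_mx d *m Q') ^+ k) =
    fun m => \sum_j series (fun k => (k`!%:R)^-1 * d 0 j ^+ k) m *: P j.
  apply/funext => m; rewrite /series /=.
  under eq_bigr do rewrite powE scaler_sumr.
  rewrite exchange_big /=; apply: eq_bigr => j _.
  by rewrite scaler_suml; apply: eq_bigr => k _; rewrite scalerA.
apply: cvg_big => [|j _]; first exact: add_continuous.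
exact: cvgZr_tmp.
Qed.

(* The topology of a numClosedFieldType is not found on the bare type R[i]. *)
Local Notation CR R := (R[i] : numClosedFieldType).

(** * The exponential on the imaginary axis *)

Definition expi (R : realType) (x : R) : R[i] := cos x +i* sin x.

(** Even powers of i are real and give the cosine terms; odd powers give the sine terms. *)
Lemma expi_coeffE (R : realType) (x : R) (k : nat) :
  (k`!%:R)^-1 * ('i * x%:C) ^+ k = cos_coeff x k +i* sin_coeff x k :> R[i].
Proof.
have iX m : 'i%C ^+ m.*2 = ((-1) ^+ m)%:C :> R[i].
  by rewrite -mul2n exprM sqr_i rmorphXn /= rmorphN1.
rewrite -complexiE exprMn mulrCA -rmorphXn /=.
rewrite -(rmorph_nat (real_complex R)) -fmorphV -rmorphM /=.
rewrite /cos_coeff /sin_coeff /= -(odd_double_half k).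
case: (odd k) (k./2) => m;
  rewrite ?add0n ?add1n /= odd_double /= !mul0r mul1r ?doubleK.
  rewrite exprS iX -mulrA -rmorphM /= mulrC.
  congr (_ +i* _); first by rewrite mulr0 mul0r subr0.
  by rewrite mulr1 mul0r addr0 mulrAC mulrA.
rewrite iX -rmorphM /=.
by congr (_ +i* _); rewrite mulrAC mulrA.
Qed.

Lemma cvg_complex (R : realType) (f g : R^nat) (a b : R) :
  (f @ \oo --> a -> g @ \oo --> b ->
   (fun n => f n +i* g n : CR R) @ \oo --> (a +i* b : CR R))%classic.
Proof.
have cvgC (h : R^nat) (c : R) :
    (h @ \oo --> c -> (fun n => (h n)%:C : CR R) @ \oo --> (c%:C : CR R))%classic.
  move=> h_c; apply/cvgrPdist_lt => e e_gt0.
  (* A positive element of [R[i]] has zero imaginary part, so the radius [e] is real. *)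
  move: (e_gt0); rewrite ltcE => /andP[/eqP/= Ime Ree].
  have /cvgrPdist_lt/(_ _ Ree) := h_c; apply: filterS => n.
  rewrite -rmorphB /= normc_def /= expr0n addr0 sqrtr_sqr.
  by rewrite (complexE e) Ime mulr0 addr0 ltcR.
move=> f_a g_b.
have -> : (fun n => f n +i* g n : CR R) =
    (fun n => (f n)%:C : CR R) + (fun n => ('i%C : CR R) * (g n)%:C).
  by apply/funext => n; exact: (complexE (f n +i* g n)).
have -> : (a +i* b : CR R) = (a%:C : CR R) + ('i%C : CR R) * b%:C.
  exact: (complexE (a +i* b)).
apply: cvgD; first exact: cvgC.
by apply: cvgMl_tmp; exact: cvgC.
Qed.

Lemma cvg_series_expi (R : realType) (x : R) :
  (series (fun k => (k`!%:R)^-1 * ('i * x%:C) ^+ k : CR R) @ \oo -->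
   (expi x : CR R))%classic.
Proof.
have -> : series (fun k => (k`!%:R)^-1 * ('i * x%:C) ^+ k : CR R) =
    fun n => series (cos_coeff x) n +i* series (sin_coeff x) n.
  apply/funext => n; rewrite /series /=; elim: n => [|n IHn].
    by rewrite !big_nil.
  by rewrite !big_nat_recr//= IHn expi_coeffE.
apply: cvg_complex.
  by rewrite unlock; exact: is_cvg_series_cos_coeff.
by rewrite unlock; exact: is_cvg_series_sin_coeff.
Qed.

Lemma norm_expi (R : realType) (x : R) : `|expi x| = 1.
Proof. by rewrite normc_def /= cos2Dsin2 sqrtr1. Qed.

(** With m the floor of x / (2 pi), write x = 2z + 2 pi m, where 0 <= z < pi. Then cos x = 1 - 2
    (sin z)^2, so cos x = 1 forces sin z = 0, hence z = 0. *)
Lemma cos_eq1 (R : realType) (x : R) :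
  (cos x == 1) = (x / (2 * pi) \is a Num.int).
Proof.
have pi2_gt0 : 0 < 2 * pi :> R by rewrite mulr_gt0 ?pi_gt0.
have cosDn (m : nat) (y : R) : cos (y + (2 * pi) * m%:R) = cos y.
  by rewrite mulr_natr mulr_natl (periodicn (@cosD2pi R)).
have cosDz (m : int) (y : R) : cos (y + (2 * pi) * m%:~R) = cos y.
  case: m => m; first exact: cosDn.
  by rewrite NegzE -(cosDn m.+1 (y + _)) rmorphN /= -addrA -mulrDr addNr mulr0
             addr0.
apply/eqP/intrP => [cosx1|[m xm]]; last first.
  by rewrite -(divfK (lt0r_neq0 pi2_gt0) x) xm mulrC -[_ * _]add0r cosDz cos0.
exists (Num.floor (x / (2 * pi))).
have := floor_itv (x / (2 * pi)); set m := Num.floor _ => /andP[mx xm].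
pose z := x / 2 - pi * m%:~R.
have zE : x = z *+ 2 + 2 * pi * m%:~R by rewrite /z -mulr_natr; field.
have z_ge0 : 0 <= z.
  by move: mx; rewrite ler_pdivlMr // {1}zE -subr_ge0 mulrC -mulr_natr; lra.
have z_ltpi : z < pi.
  by move: xm; rewrite ltr_pdivrMr // {1}zE rmorphD /= -mulr_natr; nra.
move: cosx1; rewrite zE cosDz cos_mulr2n cos2sin2 => /eqP.
have -> : ((1 - sin z ^+ 2) *+ 2 - 1 == 1) = (sin z ^+ 2 == 0).
  by rewrite -mulr_natr; apply/eqP/eqP; lra.
rewrite sqrf_eq0 => /eqP sinz0.
move: z_ge0; rewrite le_eqVlt => /predU1P[z0|z_gt0].
  by rewrite -z0 mul0rn add0r mulrAC divff ?mul1r // lt0r_neq0.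
by have := @sin_gt0_pi R z; rewrite z_gt0 z_ltpi sinz0 ltxx => /(_ isT).
Qed.

(** The squared distance between the two points is 2 - 2 cos (x - y). *)
Lemma expi_eq (R : realType) (x y : R) :
  (expi x == expi y) = ((x - y) / (2 * pi) \is a Num.int).
Proof.
rewrite -cos_eq1 cosB eq_complex /=.
have := cos2Dsin2 x; have := cos2Dsin2 y.
move: (cos x) (cos y) (sin x) (sin y) => c c' s s' h' h.
apply/andP/eqP => [[/eqP-> /eqP->]|hh]; first by rewrite -!expr2.
have : (c - c') ^+ 2 + (s - s') ^+ 2 = 0.
  transitivity (c ^+ 2 + s ^+ 2 + (c' ^+ 2 + s' ^+ 2) - 2 * (c * c' + s * s')).
    by ring.
  by rewrite h h' hh; ring.
by move/eqP; rewrite paddr_eq0 ?sqr_ge0 // !sqrf_eq0 !subr_eq0 => /andP[-> ->].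
Qed.

(** Parallelogram law; it normalizes the revival coefficients. *)
Lemma half_sum_diff_norm (C : numClosedFieldType) (w z : C) :
  `|w| = 1 -> `|z| = 1 -> `|(w + z) / 2| ^+ 2 + `|(w - z) / 2| ^+ 2 = 1.
Proof.
move=> w1 z1; have := normCK w; have := normCK z; rewrite w1 z1 expr1n => zz ww.
rewrite !normCK !rmorphM /= fmorphV !rmorphB !rmorphD /= rmorph1.
have -> : forall a b c d : C,
    (a + b) / 2 * ((c + d) / (1 + 1)) + (a - b) / 2 * ((c - d) / (1 + 1)) =
    (a * c + b * d) / 2.
  by move=> *; field.
by rewrite -ww -zz; field.
Qed.

(** * Characters of Z_2^r *)

Lemma dotC (r : nat) (s x : 'rV['Z_2]_r) : dot s x = dot x s.
Proof. by apply: eq_bigr => i _; rewrite mulnC. Qed.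

(** The natural number [dot s x] is not additive in [x], as coordinates are reduced modulo 2, but
    its parity is. *)
Lemma sign_dotD (A : comNzRingType) (r : nat) (s x y : 'rV['Z_2]_r) :
  (-1) ^+ dot s (x + y) = (-1) ^+ dot s x * (-1) ^+ dot s y :> A.
Proof.
rewrite /dot -!prodrXr -big_split /=; apply: eq_bigr => i _.
rewrite mxE -exprD -mulnDr mulnC exprM [in RHS]mulnC exprM.
congr (_ ^+ _); rewrite -signr_odd -[RHS]signr_odd; congr (_ ^+ _).
by move: (x 0 i) (y 0 i) => [[|[|?]] ?] [[|[|?]] ?].
Qed.

Lemma sign_dot0 (A : comNzRingType) (r : nat) (s : 'rV['Z_2]_r) :
  (-1) ^+ dot s 0 = 1 :> A.
Proof. by rewrite /dot big1 // => i _; rewrite mxE muln0. Qed.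

Lemma oppZ2 (r : nat) (x : 'rV['Z_2]_r) : - x = x.
Proof.
by apply/rowP => i; rewrite mxE; apply: val_inj; case: (x 0 i) => [[|[|?]] ?].
Qed.

Lemma exists_sign_dot (A : comNzRingType) (r : nat) (s : 'rV['Z_2]_r) :
  s != 0 -> exists x, (-1) ^+ dot s x = -1 :> A.
Proof.
move=> s_neq0.
have [i si] : exists i, s 0 i != 0.
  apply/existsP; apply: contra_neqT s_neq0 => /existsPn s0.
  by apply/rowP => i; rewrite mxE; apply/eqP; rewrite -[_ == _]negbK.
(* The unit vector at a nonzero coordinate of [s] has odd product with [s]. *)
exists (delta_mx 0 i); rewrite /dot (bigD1 i) //= big1 => [|j ji].
  by rewrite mxE !eqxx; move: si; case: (s 0 i) => [[|[|?]] ?].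
by rewrite mxE (negbTE ji) andbF muln0.
Qed.

Lemma sum_sign_dot (A : numDomainType) (r : nat) (s : 'rV['Z_2]_r) :
  \sum_x (-1) ^+ dot s x = if s == 0 then (2 ^ r)%:R else 0 :> A.
Proof.
have [->|s_neq0] := eqVneq s 0.
  under eq_bigr do rewrite dotC sign_dot0.
  by rewrite sumr_const card_mx card_ord mul1n.
have [d sd] := exists_sign_dot A s_neq0.
(* Translating the summation variable by [d] flips every sign. *)
set t := LHS; have : t = - t.
  rewrite -mulN1r {1}/t (reindex_inj (addrI d)) /= mulr_sumr.
  by apply: eq_bigr => x _; rewrite sign_dotD sd.
by move/eqP; rewrite -addr_eq0 -mulr2n mulrn_eq0 => /eqP.
Qed.

(** Over the integers the weight equals a.x - a.y; its evenness thus becomes equality of two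
    character values. *)
Lemma wt_diff_even (A : numDomainType) (r : nat) (a x y : 'rV['Z_2]_r) :
  (2 %| wt_diff a x y)%Z = ((-1) ^+ dot a x == (-1) ^+ dot a y :> A).
Proof.
have -> : wt_diff a x y = (dot a x)%:Z - (dot a y)%:Z.
  rewrite /wt_diff /dot -!natz !natr_sum -sumrB; apply: eq_bigr => i _.
  by rewrite mulrBr !natrM !natz.
rewrite -[in RHS]signr_odd -[X in _ == X]signr_odd (inj_eq (@signr_inj A)).
lia.
Qed.

(** * The lexicographic order and integer gcds *)

Lemma lex_gt_total (r : nat) (x y : 'rV['Z_2]_r) :
  x != y -> lex_gt x y || lex_gt y x.
Proof.
move=> xy.
have [i xyi] : exists i, x 0 i != y 0 i.
  apply/existsP; apply: contra_neqT xy => /existsPn xy0.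
  by apply/rowP => i; apply/eqP; rewrite -[_ == _]negbK.
(* The first coordinate where [x] and [y] differ decides. *)
case: (@arg_minnP _ i (fun j => x 0 j != y 0 j) val xyi) => k xyk kmin.
have eq_lt (j : 'I_r) : (j < k)%N -> x 0 j = y 0 j.
  by move=> jk; apply/eqP; apply: contraTT jk => /kmin; rewrite leqNgt.
move: xyk; rewrite neq_ltn => /orP[lt|lt]; apply/orP; [right|left];
  apply/existsP; exists k; rewrite lt andbT;
  by apply/forallP => j; apply/implyP => /eq_lt ->.
Qed.

Lemma biggcdn_dvd (I : finType) (A : {set I}) (F : I -> nat) i :
  i \in A -> (\big[gcdn/0%N]_(i in A) F i %| F i)%N.
Proof. by move=> Ai; rewrite (bigD1 i) //= dvdn_gcdl. Qed.

(** The integers m with c m integral form a subgroup, which by Bezout is closed under gcds. *)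
Lemma biggcdn_int_scale (R : archiRealFieldType) (I : finType) (A : {set I})
    (F : I -> int) (c : R) :
  (forall i, i \in A -> c * (F i)%:~R \is a Num.int) ->
  c * (\big[gcdn/0%N]_(i in A) `|F i|%N)%:R \is a Num.int.
Proof.
move=> cF; elim/big_rec: _ => [|i m Ai cm]; first by rewrite mulr0 rpred0.
have [u [v uv]] := Bezoutz (F i) m%:Z.
have -> : (gcdn `|F i| m)%:R = (gcdz (F i) m%:Z)%:~R :> R by [].
rewrite -uv rmorphD !rmorphM /= mulrDr !(mulrCA c).
by rewrite rpredD // rpredM ?intr_int ?cF.
Qed.

(** * Fourier diagonalization of the adjacency matrix *)

Lemma sum_enum_val (A : nmodType) (T : finType) (F : T -> A) :
  \sum_(i < #|T|) F (enum_val i) = \sum_x F x.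
Proof. by rewrite [RHS](reindex _ (onW_bij _ (enum_val_bij T))). Qed.

Definition cube_eigenvalue (r : nat) (S : {set 'rV['Z_2]_r})
    (x : 'rV['Z_2]_r) : int :=
  \sum_(s in S) (-1) ^+ dot s x.

Lemma char_sum_diffE (r : nat) (S : {set 'rV['Z_2]_r}) (x y : 'rV['Z_2]_r) :
  char_sum_diff S x y = cube_eigenvalue S x - cube_eigenvalue S y.
Proof. exact: sumrB. Qed.

(** The character table of Z_2^r, an unnormalized Hadamard matrix. *)
Definition fourier_mx (A : pzRingType) (r : nat) : 'M[A]_#|'rV['Z_2]_r| :=
  \matrix_(i, j) (-1) ^+ dot (enum_val i) (enum_val j).

Lemma mul_fourier_mx (A : numDomainType) (r : nat) :
  fourier_mx A r *m fourier_mx A r = (2 ^ r)%:R%:M.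
Proof.
apply/matrixP => i j; rewrite !mxE.
transitivity (\sum_x (-1) ^+ dot (enum_val i + enum_val j) x : A).
  rewrite -[RHS]sum_enum_val; apply: eq_bigr => k _.
  by rewrite !mxE [in RHS]dotC sign_dotD dotC.
(* In characteristic 2 a sum of two elements vanishes exactly when they are equal. *)
rewrite sum_sign_dot -[X in _ + X]oppZ2 subr_eq0 (inj_eq enum_val_inj).
by case: eqP.
Qed.

Lemma adjacency_fourier_mx (A : numDomainType) (r : nat) (S : {set 'rV['Z_2]_r}) :
  adjacency_mx A (cayley S) *m fourier_mx A r =
    fourier_mx A r *m diag_mx (\row_j (cube_eigenvalue S (enum_val j))%:~R).
Proof.
apply/matrixP => i j; rewrite mul_mx_diag !mxE.
transitivity (\sum_x (enum_val i - x \in S)%:R * (-1) ^+ dot x (enum_val j) : A).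
  by rewrite -[RHS]sum_enum_val; apply: eq_bigr => k _; rewrite !mxE.
(* Substituting u - s for the neighbour of u, the character value at u factors out and the
   eigenvalue remains. *)
rewrite (reindex_inj (subrI (enum_val i))) /= rmorph_sum mulr_sumr [RHS]big_mkcond.
apply: eq_bigr => s _; rewrite subKr rmorphXn rmorphN1 /= dotC sign_dotD oppZ2.
by case: (s \in S); rewrite ?mul0r // mul1r !(dotC (enum_val j)).
Qed.

Lemma fourier_mxK (C : numFieldType) (r : nat) :
  ((2 ^ r)%:R^-1 *: fourier_mx C r) *m fourier_mx C r = 1%:M.
Proof.
by rewrite -scalemxAl mul_fourier_mx scale_scalar_mx mulVf ?pnatr_eq0 ?expn_eq0.
Qed.

Lemma fourier_mx_conj (C : numFieldType) (r : nat) (D : 'M[C]_#|'rV['Z_2]_r|) :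
  fourier_mx C r *m (fourier_mx C r *m D *m ((2 ^ r)%:R^-1 *: fourier_mx C r)) =
    D *m fourier_mx C r.
Proof.
rewrite !mulmxA mul_fourier_mx mul_scalar_mx -scalemxAr -!scalemxAl scalerA.
by rewrite mulVf ?scale1r // pnatr_eq0 expn_eq0.
Qed.

Lemma adjacency_mx_diag (C : numFieldType) (r : nat) (S : {set 'rV['Z_2]_r}) (c : C) :
  c *: adjacency_mx C (cayley S) =
    fourier_mx C r *m diag_mx (\row_j (c * (cube_eigenvalue S (enum_val j))%:~R)) *m
    ((2 ^ r)%:R^-1 *: fourier_mx C r).
Proof.
rewrite -[LHS]mulmx1 -(mulmx1C (fourier_mxK C r)) mulmxA -scalemxAl.
rewrite adjacency_fourier_mx scalemxAr; congr (_ *m _ *m _).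
by apply/matrixP => i j; rewrite !mxE mulrnAr.
Qed.

Lemma transition_mxE (R : realType) (r : nat) (S : {set 'rV['Z_2]_r}) (t : R) :
  fourier_mx R[i] r *m transition_mx (cayley S) t =
    diag_mx (\row_j expi (t * (cube_eigenvalue S (enum_val j))%:~R)) *m
    fourier_mx R[i] r.
Proof.
rewrite -fourier_mx_conj /transition_mx adjacency_mx_diag; congr (_ *m _).
apply: mx_exp_diag => [|j]; first exact: fourier_mxK.
rewrite !mxE -mulrA -(rmorph_int (real_complex R)) -rmorphM.
exact: cvg_series_expi.
Qed.

(** * Criteria for fractional revival *)

(** The Fourier matrix is injective because its square is 2^r. After transforming, both sides carry
    the factor (-1)^(x.v); cancelling it removes [v] from the criterion. *)
Lemma vertex_vec_revivalP (R : realType) (r : nat) (S : {set 'rV['Z_2]_r})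
    (t : R) (v a : 'rV['Z_2]_r) (alpha beta : R[i]) :
  transition_mx (cayley S) t *m vertex_vec R[i] v =
    alpha *: vertex_vec R[i] v + beta *: vertex_vec R[i] (v + a) <->
  forall x, expi (t * (cube_eigenvalue S x)%:~R) = alpha + beta * (-1) ^+ dot a x.
Proof.
set F := fourier_mx R[i] r.
have r2_neq0 : (2 ^ r)%:R != 0 :> R[i] by rewrite pnatr_eq0 expn_eq0.
have F_inj : injective (mulmx F : 'cV_ _ -> _).
  move=> x y /(congr1 (mulmx F)); rewrite !mulmxA mul_fourier_mx !mul_scalar_mx.
  exact: scalerI.
have FvE u i : (F *m vertex_vec R[i] u) i 0 = (-1) ^+ dot (enum_val i) u.
  by rewrite -colE !mxE enum_rankK.
have lhsE i : (F *m (transition_mx (cayley S) t *m vertex_vec R[i] v)) i 0 =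
    expi (t * (cube_eigenvalue S (enum_val i))%:~R) * (-1) ^+ dot (enum_val i) v.
  by rewrite mulmxA transition_mxE -mulmxA mul_diag_mx mxE FvE mxE.
have rhsE i :
    (F *m (alpha *: vertex_vec R[i] v + beta *: vertex_vec R[i] (v + a))) i 0 =
    (alpha + beta * (-1) ^+ dot a (enum_val i)) * (-1) ^+ dot (enum_val i) v.
  rewrite mulmxDr -!scalemxAr [LHS]mxE [X in X + _]mxE [X in _ + X]mxE !FvE.
  by rewrite sign_dotD (dotC _ a) mulrDl -mulrA [X in _ + _ * X]mulrC.
split=> [revival x|eigen].
  apply: (@mulIf _ ((-1) ^+ dot x v)); first by rewrite signr_eq0.
  by rewrite -(enum_rankK x) -lhsE -rhsE revival.
by apply: F_inj; apply/colP => i; rewrite lhsE rhsE eigen.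
Qed.

(* Any two unimodular values w0, w1 are those of alpha + beta chi_a, for
   alpha = (w0 + w1) / 2 and beta = (w0 - w1) / 2. *)
Lemma frac_revival_fromP (R : realType) (r : nat) (S : {set 'rV['Z_2]_r})
    (t : R) (v a : 'rV['Z_2]_r) :
  a != 0 ->
  frac_revival_from (cayley S) t v (v + a) <->
  forall x y, (2 %| wt_diff a x y)%Z ->
    expi (t * (cube_eigenvalue S x)%:~R) = expi (t * (cube_eigenvalue S y)%:~R).
Proof.
move=> a_neq0; split=> [[_ [alpha [beta [_ /vertex_vec_revivalP eigen]]]] x y|eigen].
  by rewrite (wt_diff_even R[i]) => /eqP axy; rewrite !eigen axy.
split; first by apply/eqP; rewrite eq_sym addrC -subr_eq0 addrK.
(* The character of [a] takes the value 1 at 0 and -1 at [z], so these two points represent the two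
   parity classes. *)
have [z az] : exists z, (-1) ^+ dot a z = -1 :> R[i].
  exact: exists_sign_dot.
pose w x := expi (t * (cube_eigenvalue S x)%:~R).
exists ((w 0 + w z) / 2), ((w 0 - w z) / 2); split.
  by apply: half_sum_diff_norm; exact: norm_expi.
apply/vertex_vec_revivalP => x; rewrite -/(w x).
have [ax|ax] : (-1) ^+ dot a x = 1 :> R[i] \/ (-1) ^+ dot a x = -1 :> R[i].
  by rewrite -signr_odd; case: odd; [right|left].
- rewrite (_ : w x = w 0); first by rewrite ax; field.
  by apply: eigen; rewrite (wt_diff_even R[i]) ax sign_dot0.
- rewrite (_ : w x = w z); first by rewrite ax; field.
  by apply: eigen; rewrite (wt_diff_even R[i]) ax az.
Qed.

(** The eigenvalue condition is symmetric in the pair and trivial on the diagonal, so the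
    lexicographically ordered pairs in N suffice. *)
Lemma frac_revival_betweenP (R : realType) (r : nat) (S : {set 'rV['Z_2]_r})
    (t : R) (v a : 'rV['Z_2]_r) :
  a != 0 ->
  frac_revival_between (cayley S) t v (v + a) <->
  forall x y, (x, y) \in Npairs a ->
      t / (2 * pi) * (char_sum_diff S x y)%:~R \is a Num.int.
Proof.
move=> a_neq0.
have expiE x y :
    (expi (t * (cube_eigenvalue S x)%:~R) ==
     expi (t * (cube_eigenvalue S y)%:~R)) =
    (t / (2 * pi) * (char_sum_diff S x y)%:~R \is a Num.int).
  by rewrite expi_eq -mulrBr mulrAC char_sum_diffE rmorphB.
have fromP u := frac_revival_fromP S t u a_neq0.
split=> [[/fromP eigen _] x y|tN].
  by rewrite inE -expiE => /andP[_ axy]; apply/eqP; exact: eigen.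
have eigen x y : (2 %| wt_diff a x y)%Z ->
    expi (t * (cube_eigenvalue S x)%:~R) = expi (t * (cube_eigenvalue S y)%:~R).
  move=> axy; have [->//|xy] := eqVneq x y.
  apply/eqP; case/orP: (lex_gt_total xy) => gt.
    by rewrite expiE tN // inE gt.
  rewrite eq_sym expiE tN // inE gt /=.
  by move: axy; rewrite !(wt_diff_even R) eq_sym.
split; first exact/fromP.
(* Since v = (v + a) + a, the reverse direction is the same criterion at the start vertex v + a. *)
rewrite -[X in frac_revival_from _ _ _ X](addrK a) oppZ2; exact/fromP.
Qed.

Theorem corollary2p4 (R : realType) (r : nat) (S : {set 'rV['Z_2]_r})
    (v a : 'rV['Z_2]_r) (t : R)
    (r_ge1 : (1 <= r)%N) (S_not0 : 0 \notin S) (a_order2 : #[a]%g = 2%N) :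
  (frac_revival_between (cayley S) t v (v + a) <->
   (forall x y : 'rV['Z_2]_r, (x, y) \in Npairs a ->
      t / (2 * pi) * (char_sum_diff S x y)%:~R \is a Num.int))
  /\
  ((forall x y : 'rV['Z_2]_r, (x, y) \in Npairs a ->
      t / (2 * pi) * (char_sum_diff S x y)%:~R \is a Num.int) ->
   (* for M = 0 the quotient 2 * pi / M is meaningless *)
   Mgcd S a <> 0%N ->
   [/\ 0 < 2 * pi / (Mgcd S a)%:R :> R,
       frac_revival_between (cayley S) (2 * pi / (Mgcd S a)%:R : R) v (v + a)
     & forall t' : R, 0 < t' -> frac_revival_between (cayley S) t' v (v + a) ->
         2 * pi / (Mgcd S a)%:R <= t']).
Proof.
have a_neq0 : a != 0 by rewrite -order_gt1 a_order2.
have iffP t' := frac_revival_betweenP S t' v a_neq0.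
split; first exact: iffP.
move=> _ /eqP M_neq0; have M_gt0 : 0 < (Mgcd S a)%:R :> R by rewrite ltr0n lt0n.
have pi2_gt0 : 0 < 2 * pi :> R by rewrite mulr_gt0 ?pi_gt0.
split=> [||t' t'_gt0 /iffP t'N]; first exact: divr_gt0.
  apply/iffP => x y xyN.
  (* Each difference is q M, so at time 2 pi / M the quantity in the criterion is the integer q. *)
  have /dvdzP[q ->] : ((Mgcd S a)%:Z %| char_sum_diff S x y)%Z.
    rewrite dvdzE.
    exact: (biggcdn_dvd (fun p => `|char_sum_diff S p.1 p.2|%N) xyN).
  rewrite intrM -pmulrn [2 * pi / _]mulrC mulfK ?lt0r_neq0 //.
  by rewrite mulrCA mulVf ?lt0r_neq0 // mulr1 intr_int.
have /intrP[m mE] : t' / (2 * pi) * (Mgcd S a)%:R \is a Num.int.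
  apply: (@biggcdn_int_scale _ _ (Npairs a) (fun p => char_sum_diff S p.1 p.2)).
  by case=> x y; exact: t'N.
(* The integer m = t' M / (2 pi) is positive, hence at least 1, which bounds t' below by 2 pi /
   M. *)
have m_ge1 : 1 <= m%:~R :> R.
  by rewrite ler1z -gtz0_ge1 -(ltr0z R) -mE mulr_gt0 ?divr_gt0.
rewrite ler_pdivrMr // -[leLHS]mul1r -ler_pdivlMr //.
by rewrite mulrAC mE.
Qed.
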